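(* Let $I$ be a finite nonempty set, let $\{A_i \mid i \in I\}$ be a family of solvable groups, let $C$ be a group, and for each $i \in I$ let $\phi_i : C \to A_i$ be a monomorphism whose image $\phi_i(C)$ is contained in the center $Z(A_i)$ of $A_i$. Then the generalized free product $G$ of the groups $A_i$ ($i \in I$) amalgamating $C$ via the monomorphisms $\phi_i$ is residually solvable.
   Context: The generalized free product of the $A_i$ amalgamating $C$ via monomorphisms $\phi_i : C \to A_i$ is the quotient of the free product of all the $A_i$ by the normal closure of the set $\{\phi_i(c)\,\phi_j(c)^{-1} : c \in C,\ i, j \in I\}$. A group $G$ is residually solvable if for every non-identity element $g \in G$ there is a homomorphism $\psi$ from $G$ to a solvable group such that $\psi(g) \neq 1$. *)

(* Defs.v *)
From HB Require Import structures.
From Stdlib Require Import Relation_Operators.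
From mathcomp Require Import all_boot.
From mathcomp Require Import boolp classical_sets.

Set Implicit Arguments.
Unset Strict Implicit.
Unset Printing Implicit Defensive.

Local Open Scope classical_set_scope.
Local Open Scope quotient_scope.
Local Open Scope group_scope.

(* The carrier of a [groupType] need not be finite, so none of the [fingroup]
   notions apply; subgroups are predicates of type [set G]. *)

(* Between groups these are exactly the group homomorphisms. *)
Notation ghom := UMagmaMorphism.type.

Section Subgroups.
Variable G : groupType.
Implicit Types S H : set G.

Definition is_subgroup H : Prop :=
  [/\ H 1, forall x y, H x -> H y -> H (x * y) & forall x, H x -> H x^-1].

Definition is_normal H : Prop :=
  is_subgroup H /\ forall x y, H x -> H (x ^ y).

Definition generated S : set G :=
  [set x | forall H, is_subgroup H -> S `<=` H -> H x].

Definition normal_closure S : set G :=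
  [set x | forall H, is_normal H -> S `<=` H -> H x].

Definition center : set G := [set z | forall x, commute z x].

Definition commutator_subgroup S : set G :=
  generated [set z | exists x y, [/\ S x, S y & z = [~ x, y]]].

Fixpoint derived_series (n : nat) : set G :=
  if n is n'.+1 then commutator_subgroup (derived_series n') else setT.

Lemma normal_closure_normal S : is_normal (normal_closure S).
Proof.
split; last first.
  by move=> x y Hx K nK sK; apply: (nK.2); apply: Hx.
split=> [K [[K1 _ _] _] _ //|x y Hx Hy K nK sK|x Hx K nK sK].
  by case: (nK) => [[_ KM _] _]; apply: KM; [apply: Hx|apply: Hy].
by case: (nK) => [[_ _ KV] _]; apply: KV; apply: Hx.
Qed.

End Subgroups.

Arguments center G : clear implicits.
Arguments derived_series G n : clear implicits.

Definition solvable_group (G : groupType) : Prop :=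
  exists n, derived_series G n = [set 1].

Definition residually_solvable (G : groupType) : Prop :=
  forall g : G, g <> 1 ->
    exists (H : groupType) (psi : ghom G H), solvable_group H /\ psi g <> 1.

Record normalSubgroup (G : groupType) := NormalSubgroup {
  nsg_set :> G -> Prop;
  nsgP : is_normal nsg_set
}.

Definition normal_closure_nsg (G : groupType) (S : set G) : normalSubgroup G :=
  NormalSubgroup (normal_closure_normal S).

Section QuotientGroup.
Variables (G : groupType) (N : normalSubgroup G).

Definition coset_rel : rel G := fun x y => `[< N (x^-1 * y) >].

Lemma N1 : N 1. Proof. by have [[]] := nsgP N. Qed.
Lemma NM x y : N x -> N y -> N (x * y).
Proof. by have [[_ + _] _] := nsgP N; apply. Qed.
Lemma NV x : N x -> N x^-1.
Proof. by have [[_ _ +] _] := nsgP N; apply. Qed.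
Lemma NJ x y : N x -> N (x ^ y).
Proof. by have [_ +] := nsgP N; apply. Qed.

Lemma coset_rel_refl : reflexive coset_rel.
Proof. by move=> x; apply/asboolP; rewrite mulVg; apply: N1. Qed.

Lemma coset_rel_sym : symmetric coset_rel.
Proof.
move=> x y; apply/asboolP/asboolP => /NV; by rewrite invgM invgK.
Qed.

Lemma coset_rel_trans : transitive coset_rel.
Proof.
move=> y x z /asboolP xy /asboolP yz; apply/asboolP.
by have := NM xy yz; rewrite mulgA mulgK.
Qed.

Canonical coset_equiv :=
  EquivRel coset_rel coset_rel_refl coset_rel_sym coset_rel_trans.

Definition quotient_group := {eq_quot coset_rel}.
HB.instance Definition _ := Choice.on quotient_group.

Definition qclass (x : G) : quotient_group := \pi x.

Lemma qclassP x y : qclass x = qclass y <-> N (x^-1 * y).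
Proof.
split=> [/eqmodP/asboolP //|Nxy].
by apply/eqmodP/asboolP.
Qed.

Lemma qclassK (u : quotient_group) : qclass (repr u) = u.
Proof. exact: reprK. Qed.

Definition qmul (u v : quotient_group) : quotient_group :=
  qclass (repr u * repr v).
Definition qone : quotient_group := qclass 1.
Definition qinv (u : quotient_group) : quotient_group := qclass (repr u)^-1.

Lemma qmulE x y : qmul (qclass x) (qclass y) = qclass (x * y).
Proof.
apply/qclassP; set x' := repr _; set y' := repr _.
have Nx : N (x'^-1 * x) by apply/qclassP; rewrite qclassK.
have Ny : N (y'^-1 * y) by apply/qclassP; rewrite qclassK.
have := NM (NJ y' Nx) Ny.
by rewrite conjgE invgM !mulgA mulgK.
Qed.

Lemma qinvE x : qinv (qclass x) = qclass x^-1.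
Proof.
apply/qclassP; set x' := repr _.
have Nx : N (x'^-1 * x) by apply/qclassP; rewrite qclassK.
have := NJ x'^-1 (NV Nx).
by rewrite conjgE invgM !invgK !mulgA mulgK.
Qed.

Lemma qmulA : associative qmul.
Proof.
by move=> u v w; rewrite -(qclassK u) -(qclassK v) -(qclassK w) !qmulE mulgA.
Qed.
Lemma qmul1 : left_id qone qmul.
Proof. by move=> u; rewrite -(qclassK u) qmulE mul1g. Qed.
Lemma qmulr1 : right_id qone qmul.
Proof. by move=> u; rewrite -(qclassK u) qmulE mulg1. Qed.
Lemma qmulV : left_inverse qone qinv qmul.
Proof. by move=> u; rewrite -(qclassK u) qinvE qmulE mulVg. Qed.
Lemma qmulrV : right_inverse qone qinv qmul.
Proof. by move=> u; rewrite -(qclassK u) qinvE qmulE mulgV. Qed.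

HB.instance Definition _ :=
  isGroup.Build quotient_group qmulA qmul1 qmulr1 qmulV qmulrV.

Lemma qclassM x y : qclass (x * y) = qclass x * qclass y.
Proof. by rewrite -qmulE. Qed.

End QuotientGroup.

Section FreeProduct.
Variables (I : finType) (A : I -> groupType).

Definition word := seq {i : I & A i}.

Definition letter i (a : A i) : {i : I & A i} := Tagged A a.

(* The free product is the set of words in the disjoint union of the A i, up to
   deletion of identity letters and multiplication of adjacent letters that come
   from the same factor, with concatenation as product. *)
Inductive word_step : word -> word -> Prop :=
| word_unit (s t : word) (i : I) : word_step (s ++ letter (1 : A i) :: t) (s ++ t)
| word_mul (s t : word) (i : I) (a b : A i) :
    word_step (s ++ letter a :: letter b :: t) (s ++ letter (a * b) :: t).

Definition word_eq : word -> word -> Prop := clos_refl_sym_trans word word_step.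

Definition word_rel : rel word := fun s t => `[< word_eq s t >].

Lemma word_rel_refl : reflexive word_rel.
Proof. by move=> s; apply/asboolP; apply: rst_refl. Qed.
Lemma word_rel_sym : symmetric word_rel.
Proof. by move=> s t; apply/asboolP/asboolP; apply: rst_sym. Qed.
Lemma word_rel_trans : transitive word_rel.
Proof.
by move=> t s u /asboolP st /asboolP tu; apply/asboolP; apply: rst_trans tu.
Qed.

Canonical word_equiv :=
  EquivRel word_rel word_rel_refl word_rel_sym word_rel_trans.

Definition free_product := {eq_quot word_rel}.
HB.instance Definition _ := Choice.on free_product.

Definition wclass (s : word) : free_product := \pi s.

Lemma wclassP s t : wclass s = wclass t <-> word_eq s t.
Proof.
split=> [/eqmodP/asboolP //|st].
by apply/eqmodP/asboolP.
Qed.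

Lemma wclassK (u : free_product) : wclass (repr u) = u.
Proof. exact: reprK. Qed.

Definition letterV (l : {i : I & A i}) : {i : I & A i} :=
  let: existT i a := l in letter a^-1.

Definition winv (s : word) : word := rev (map letterV s).

Definition fmul (u v : free_product) : free_product := wclass (repr u ++ repr v).
Definition fone : free_product := wclass [::].
Definition finv (u : free_product) : free_product := wclass (winv (repr u)).

Lemma word_eq_cat s s' t t' :
  word_eq s s' -> word_eq t t' -> word_eq (s ++ t) (s' ++ t').
Proof.
move=> ss' tt'; apply: (@rst_trans _ _ _ (s' ++ t)).
  elim: ss' => [x y [p q i|p q i a b]|x|x y _ IH|x y z _ IH1 _ IH2].
  - by rewrite -!catA; apply: rst_step; apply: word_unit.
  - by rewrite -!catA; apply: rst_step; apply: word_mul.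
  - exact: rst_refl.
  - exact: rst_sym.
  - exact: rst_trans IH1 IH2.
elim: tt' => [x y [p q i|p q i a b]|x|x y _ IH|x y z _ IH1 _ IH2].
- by rewrite !catA; apply: rst_step; apply: word_unit.
- by rewrite !catA; apply: rst_step; apply: word_mul.
- exact: rst_refl.
- exact: rst_sym.
- exact: rst_trans IH1 IH2.
Qed.

Lemma winv_cat s t : winv (s ++ t) = winv t ++ winv s.
Proof. by rewrite /winv map_cat rev_cat. Qed.

Lemma winv_cons l s : winv (l :: s) = winv s ++ [:: letterV l].
Proof. by rewrite /winv /= rev_cons -cats1. Qed.

Lemma winvK : involutive winv.
Proof.
move=> s; rewrite /winv map_rev revK -map_comp -[RHS]map_id.
by apply: eq_map => -[i a] /=; rewrite /letter /= invgK.
Qed.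

Lemma word_eq_mulV s : word_eq (s ++ winv s) [::].
Proof.
elim: s => [|[i a] s IH]; first exact: rst_refl.
rewrite winv_cons -[_ ++ (_ ++ _)]/([:: letter a] ++ (s ++ (winv s ++ _))).
rewrite (catA s).
apply: (@rst_trans _ _ _ ([:: letter a] ++ [:: letter a^-1])).
  apply: word_eq_cat; first exact: rst_refl.
  by rewrite -[X in word_eq _ X]cat0s; apply: word_eq_cat IH _; apply: rst_refl.
apply: (@rst_trans _ _ _ [:: letter (1 : A i)]).
  by rewrite -(mulgV a); apply: rst_step; apply: (word_mul [::] [::]).
by apply: rst_step; apply: (word_unit [::] [::]).
Qed.

Lemma word_eq_mulVr s : word_eq (winv s ++ s) [::].
Proof. by have := word_eq_mulV (winv s); rewrite winvK. Qed.

Lemma fmulE s t : fmul (wclass s) (wclass t) = wclass (s ++ t).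
Proof. by apply/wclassP/word_eq_cat; apply/wclassP; rewrite wclassK. Qed.

Lemma fmulA : associative fmul.
Proof.
by move=> u v w; rewrite -(wclassK u) -(wclassK v) -(wclassK w) !fmulE catA.
Qed.
Lemma fmul1 : left_id fone fmul.
Proof. by move=> u; rewrite -(wclassK u) fmulE. Qed.
Lemma fmulr1 : right_id fone fmul.
Proof. by move=> u; rewrite -(wclassK u) fmulE cats0. Qed.
Lemma fmulV : left_inverse fone finv fmul.
Proof.
move=> u; rewrite -[X in fmul _ X](wclassK u) fmulE.
by apply/wclassP/word_eq_mulVr.
Qed.
Lemma fmulrV : right_inverse fone finv fmul.
Proof.
move=> u; rewrite -[X in fmul X](wclassK u) fmulE.
by apply/wclassP/word_eq_mulV.
Qed.

HB.instance Definition _ :=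
  isGroup.Build free_product fmulA fmul1 fmulr1 fmulV fmulrV.

Definition fp_in i (a : A i) : free_product := wclass [:: letter a].

Lemma fp_inM i (a b : A i) : fp_in (a * b) = fp_in a * fp_in b.
Proof.
rewrite [RHS]fmulE; apply/wclassP/rst_sym/rst_step.
exact: (word_mul [::] [::]).
Qed.

End FreeProduct.

Section Amalgam.
Variables (I : finType) (A : I -> groupType) (C : groupType).
Variable phi : forall i, ghom C (A i).

Definition amalgam_relators : set (free_product A) :=
  [set w | exists (c : C) (i j : I),
     w = fp_in (phi i c) * (fp_in (phi j c))^-1].

Definition amalgamated_product : groupType :=
  quotient_group (normal_closure_nsg amalgam_relators).

End Amalgam.

(* Main.v *)
(* Let Z be the image of C.  The group G maps onto a solvable group D, the
   direct product of the A i with the copies of C identified, and each A i embeds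
   in D.  Every element of G is z a_1 ... a_k with z in Z, the a_j outside Z, and
   neighbouring a_j in different factors.  If k = 0, the element survives in D.
   Otherwise we build, by induction on k, a solvable group H and compatible
   embeddings of the A i in H for which the suffixes of a_1 ... a_k have values in
   distinct cosets of Z.  To pass from w to a w with a in A i, replace H by the
   wreath product of Z/2 with H and conjugate the embedding of A i by the
   indicator function of the coset Z w.  The functions are Z-invariant, so the
   embeddings still agree on C.  The base-group component at 1 of the value of a
   word is the sum, over its letters, of the differences of the indicator function
   between consecutive suffixes; as w is reduced and its suffixes are separated,
   it vanishes on all suffixes of w and equals 1 on a w. *)

Require Import Defs.
From HB Require Import structures.
From mathcomp Require Import all_boot.
From mathcomp Require Import boolp classical_sets.

Local Open Scope classical_set_scope.

Section CentralAmalgam.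
Set Implicit Arguments.
Unset Strict Implicit.
Local Open Scope quotient_scope.
Local Open Scope group_scope.

Definition morph_ghom (G H : groupType) (f : G -> H)
    (fM : {morph f : x y / x * y}) : ghom G H :=
  let f1 : f 1 = 1 := mulgI (f 1) _ _ (etrans (esym (fM 1 1))
    (etrans (congr1 f (mulg1 1)) (esym (mulg1 (f 1))))) in
  HB.pack f (isMultiplicative.Build G H f fM)
    (Multiplicative_isUMagmaMorphism.Build G H f f1).

Lemma is_subgroup1 (G : groupType) : is_subgroup [set (1 : G)].
Proof.
by split=> [|x y -> ->|x ->] /=; rewrite ?mulg1 ?invg1.
Qed.

(** * Derived series and closure properties of solvable groups *)

Section DerivedSeries.
Variable G : groupType.

Lemma generated_sub (S H : set G) : is_subgroup H -> S `<=` H -> generated S `<=` H.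
Proof. by move=> sgH sSH x; apply. Qed.

Lemma sub_generated (S : set G) : S `<=` generated S.
Proof. by move=> x Sx H _; apply. Qed.

Lemma generated_subgroup (S : set G) : is_subgroup (generated S).
Proof.
split=> [H [H1 _ _] _ //|x y gx gy H sgH sSH|x gx H sgH sSH].
  by have [_ HM _] := sgH; apply: HM; [apply: gx | apply: gy].
by have [_ _ HV] := sgH; exact: HV (gx _ sgH sSH).
Qed.

Lemma derived_series_subgroup n : is_subgroup (derived_series G n).
Proof. by case: n => [|n]; [split | apply: generated_subgroup]. Qed.

(** Each term of the derived series is the least subgroup containing the commutators of the previous
    one, so a chain of subgroups absorbing commutators bounds it. *)
Lemma derived_series_sub (F : nat -> set G) n :
  (forall m, is_subgroup (F m)) -> F 0 = setT ->
  (forall m x y, m < n -> F m x -> F m y -> F m.+1 [~ x, y]) ->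
  derived_series G n `<=` F n.
Proof.
move=> sgF F0 FR; elim: n FR => [|n IH] FR; first by rewrite F0.
apply: generated_sub => // _ [x [y [dx dy ->]]].
have sub : derived_series G n `<=` F n by apply: IH => m u v /ltnW; apply: FR.
by apply: FR => //; apply: sub.
Qed.

Lemma derived_seriesR n x y : derived_series G n x -> derived_series G n y ->
  derived_series G n.+1 [~ x, y].
Proof. by move=> dx dy; apply: sub_generated; exists x, y. Qed.

Lemma derived_series_anti m n : m <= n -> derived_series G n `<=` derived_series G m.
Proof.
have anti1 k : derived_series G k.+1 `<=` derived_series G k.
  elim: k => [//|k IH]; apply: generated_sub.
    exact: derived_series_subgroup.
  by move=> _ [x [y [dx dy ->]]]; apply: derived_seriesR; apply: IH.
elim: n => [|n IH]; first by rewrite leqn0 => /eqP->.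
rewrite leq_eqVlt => /predU1P[-> //|]; rewrite ltnS => /IH sub x /anti1.
exact: sub.
Qed.

Lemma solvableP :
  solvable_group G <-> exists n, derived_series G n `<=` [set 1].
Proof.
split=> [[n d1]|[n sub1]]; first by exists n; rewrite d1.
exists n; apply/seteqP; split=> // x ->.
by have [] := derived_series_subgroup n.
Qed.

End DerivedSeries.

Lemma preim_subgroup (G H : groupType) (f : ghom G H) (K : set H) :
  is_subgroup K -> is_subgroup (f @^-1` K).
Proof.
move=> [K1 KM KV]; split=> [|x y Kx Ky|x Kx] /=; first by rewrite gmulf1.
  by rewrite gmulfM; apply: KM.
by rewrite gmulfV; apply: KV.
Qed.

Lemma derived_series_morph (G H : groupType) (f : ghom G H) n :
  derived_series G n `<=` f @^-1` derived_series H n.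
Proof.
apply: (derived_series_sub (F := fun m => f @^-1` derived_series H m)) => //.
  by move=> m; apply/preim_subgroup/derived_series_subgroup.
by move=> m x y _ dx dy; rewrite /preimage /= gmulfR; apply: derived_seriesR.
Qed.

(** After [n] steps the derived series of [G] lies in the kernel, whose elements commute, so one
    more step ends it. *)
Lemma solvable_extension (G H : groupType) (f : ghom G H) :
  (forall x y, f x = 1 -> f y = 1 -> commute x y) ->
  solvable_group H -> solvable_group G.
Proof.
move=> kerC /solvableP[n dH]; apply/solvableP; exists n.+1.
apply: generated_sub; first exact: is_subgroup1.
move=> _ [x [y [dx dy ->]]].
by apply/eqP/commgP/kerC; apply/dH/(derived_series_morph f).
Qed.

Lemma solvable_image (G H : groupType) (f : ghom G H) :
  (forall y, exists x, f x = y) -> solvable_group G -> solvable_group H.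
Proof.
move=> f_surj /solvableP[n dG]; apply/solvableP; exists n.
have dsub : derived_series H n `<=` f @` derived_series G n.
  apply: (derived_series_sub (F := fun m => f @` derived_series G m)) => [m||].
  - have [d1 dM dV] := derived_series_subgroup G m.
    split=> [|_ _ [x dx <-] [y dy <-]|_ [x dx <-]].
    + by exists 1 => //; rewrite gmulf1.
    + by exists (x * y); [apply: dM | rewrite gmulfM].
    + by exists x^-1; [apply: dV | rewrite gmulfV].
  - by apply/seteqP; split=> // y _; have [x <-] := f_surj y; exists x.
  - move=> m _ _ _ [x dx <-] [y dy <-]; exists [~ x, y]; last by rewrite gmulfR.
    exact: derived_seriesR.
by move=> _ /dsub[x /dG-> <-] /=; rewrite gmulf1.
Qed.

(** * Direct products over a finite index set *)

Section DirectProduct.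
Variables (I : finType) (A : I -> groupType).

Definition direct_product := forall i, A i.
HB.instance Definition _ := Choice.on direct_product.
Implicit Types p q r : direct_product.

Definition dp_mul p q : direct_product := fun i => p i * q i.
Definition dp_one : direct_product := fun=> 1.
Definition dp_inv p : direct_product := fun i => (p i)^-1.

Lemma dp_mulA : associative dp_mul.
Proof. by move=> p q r; apply: functional_extensionality_dep => i; apply: mulgA. Qed.
Lemma dp_mul1 : left_id dp_one dp_mul.
Proof. by move=> p; apply: functional_extensionality_dep => i; apply: mul1g. Qed.
Lemma dp_mulr1 : right_id dp_one dp_mul.
Proof. by move=> p; apply: functional_extensionality_dep => i; apply: mulg1. Qed.
Lemma dp_mulV : left_inverse dp_one dp_inv dp_mul.
Proof. by move=> p; apply: functional_extensionality_dep => i; apply: mulVg. Qed.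
Lemma dp_mulrV : right_inverse dp_one dp_inv dp_mul.
Proof. by move=> p; apply: functional_extensionality_dep => i; apply: mulgV. Qed.

HB.instance Definition _ :=
  isGroup.Build direct_product dp_mulA dp_mul1 dp_mulr1 dp_mulV dp_mulrV.

Lemma dp_projM i : {morph (fun p : direct_product => p i) : p q / p * q}.
Proof. by []. Qed.

Definition dp_in i (a : A i) : direct_product := @dfwith I A (fun=> 1) i a.

Lemma dp_inM i : {morph @dp_in i : a b / a * b}.
Proof.
move=> a b; apply: functional_extensionality_dep => j.
rewrite dp_projM /dp_in.
have [<-|ne_ij] := eqVneq i j; first by rewrite !dfwith_in.
by rewrite !dfwith_out ?mulg1.
Qed.

Lemma solvable_direct_product :
  (forall i, solvable_group (A i)) -> solvable_group direct_product.
Proof.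
move=> solA; have /all_sig[n dA] i : {n | derived_series (A i) n `<=` [set 1]}.
  by apply/cid/solvableP.
(* Finiteness of [I] gives one bound for the derived lengths of all factors. *)
apply/solvableP; exists (\max_i n i) => p dp.
apply: functional_extensionality_dep => i; apply: dA.
apply: (derived_series_anti (leq_bigmax i)).
exact: (derived_series_morph (morph_ghom (dp_projM i)) dp).
Qed.

End DirectProduct.

(* (Z/2)^H extended by H, with Z/2 encoded as [bool] under [addb]. *)
Section Wreath.
Variable H : groupType.

Definition wreath := ((H -> bool) * H)%type.
HB.instance Definition _ := Choice.on wreath.
Implicit Types v w : wreath.

Definition wr_mul v w : wreath :=
  (fun x => v.1 (w.2 * x) (+) w.1 x, v.2 * w.2).
Definition wr_one : wreath := (fun=> false, 1).
Definition wr_inv v : wreath := (fun x => v.1 (v.2^-1 * x), v.2^-1).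

Lemma wreath_eq v w : v.1 =1 w.1 -> v.2 = w.2 -> v = w.
Proof. by case: v w => [f h] [g k] /= /funext-> ->. Qed.

Lemma wr_mulA : associative wr_mul.
Proof. by move=> u v w; apply: wreath_eq => [x|] /=; rewrite ?addbA mulgA. Qed.
Lemma wr_mul1 : left_id wr_one wr_mul.
Proof. by move=> v; apply: wreath_eq => [x|] //=; rewrite mul1g. Qed.
Lemma wr_mulr1 : right_id wr_one wr_mul.
Proof. by move=> v; apply: wreath_eq => [x|] /=; rewrite ?addbF ?mul1g ?mulg1. Qed.
Lemma wr_mulV : left_inverse wr_one wr_inv wr_mul.
Proof. by move=> v; apply: wreath_eq => [x|] /=; rewrite ?mulKg ?addbb ?mulVg. Qed.
Lemma wr_mulrV : right_inverse wr_one wr_inv wr_mul.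
Proof. by move=> v; apply: wreath_eq => [x|] /=; rewrite ?addbb ?mulgV. Qed.

HB.instance Definition _ :=
  isGroup.Build wreath wr_mulA wr_mul1 wr_mulr1 wr_mulV wr_mulrV.

Lemma wreath_sndM : {morph (fun v : wreath => v.2) : v w / v * w}.
Proof. by []. Qed.

(** The kernel of the projection to [H] is the base group, where the product is pointwise [addb]. *)
Lemma solvable_wreath : solvable_group H -> solvable_group wreath.
Proof.
apply: (solvable_extension (f := morph_ghom wreath_sndM)) => v w /= v1 w1.
by apply: wreath_eq => [x|] /=; rewrite v1 w1 // !mul1g addbC.
Qed.

(* h |-> (0, h), conjugated by (u, 1). *)
Definition twist (u : H -> bool) (h : H) : wreath :=
  (fun x => u (h * x) (+) u x, h).

(** In the product the two copies of [u (k * x)] cancel. *)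
Lemma twistM u : {morph twist u : h k / h * k}.
Proof.
move=> h k; apply: wreath_eq => [x|] //=.
by rewrite mulgA addbA addbK.
Qed.

End Wreath.

Section Amalgam.
Variables (I : finType) (A : I -> groupType) (C : groupType).
Variable phi : forall i, ghom C (A i).
Hypothesis phi_inj : forall i, injective (phi i).
Hypothesis phi_central : forall i, range (phi i) `<=` center (A i).

(** The index matters: for empty [I] nothing constrains [C]. *)
Lemma amalgamated_commute (i : I) (c d : C) : commute c d.
Proof.
have zc : center (A i) (phi i c) by apply: phi_central; exists c.
by apply: (@phi_inj i); rewrite !gmulfM zc.
Qed.

(** * Evaluation of words and homomorphisms out of the amalgam *)

Section Evaluation.
Variables (H : groupType) (psi : forall i, ghom (A i) H).

Definition ev (w : word A) : H := \prod_(l <- w) psi (tag l) (tagged l).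

Definition compatible := forall i j c, psi i (phi i c) = psi j (phi j c).

Lemma ev_cons l w : ev (l :: w) = psi (tag l) (tagged l) * ev w.
Proof. exact: big_cons. Qed.

Lemma ev_letter i (a : A i) w : ev (letter a :: w) = psi i a * ev w.
Proof. exact: ev_cons. Qed.

Lemma ev_cat s t : ev (s ++ t) = ev s * ev t.
Proof. exact: big_cat. Qed.

Lemma ev_word_eq s t : word_eq s t -> ev s = ev t.
Proof.
elim=> [_ _ [p q i|p q i a b]|x|x y _ ->|x y z _ -> _ ->] //.
  by rewrite !ev_cat ev_letter gmulf1 mul1g.
by rewrite !ev_cat !ev_letter gmulfM -mulgA.
Qed.

Definition free_lift (u : free_product A) : H := ev (repr u).

Lemma free_liftE s : free_lift (wclass s) = ev s.
Proof. by apply: ev_word_eq; apply/wclassP; rewrite wclassK. Qed.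

Lemma free_liftM : {morph free_lift : u v / u * v}.
Proof.
by move=> u v; rewrite -(wclassK u) -(wclassK v) [_ * _]fmulE !free_liftE ev_cat.
Qed.

Hypothesis psi_compat : compatible.

Lemma free_lift_relators : normal_closure (amalgam_relators phi) `<=`
  free_lift @^-1` [set 1].
Proof.
pose f := morph_ghom free_liftM.
move=> u; apply=> [|_ [c [i [j ->]]]].
  split; first exact: (preim_subgroup f (is_subgroup1 H)).
  by move=> x y fx; rewrite /preimage /= -[free_lift _]/(f _) gmulfJ [f x]fx conj1g.
rewrite /preimage /= -[free_lift _]/(f _) gmulfF /= !free_liftE !ev_letter.
rewrite [ev _]big_nil !mulg1.
by rewrite (psi_compat i j) mulgV.
Qed.

Definition amalgam_lift (g : amalgamated_product phi) : H := free_lift (repr g).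

Lemma amalgam_liftE u : amalgam_lift (qclass _ u) = free_lift u.
Proof.
have /qclassP/free_lift_relators :=
  qclassK (qclass (normal_closure_nsg (amalgam_relators phi)) u).
pose f := morph_ghom free_liftM.
rewrite /preimage /= -[free_lift _]/(f _) gmulfM gmulfV.
by move/mulg1_eq; rewrite invgK.
Qed.

Lemma amalgam_liftM : {morph amalgam_lift : g h / g * h}.
Proof.
move=> g h; rewrite -(qclassK g) -(qclassK h) -qclassM !amalgam_liftE.
exact: free_liftM.
Qed.

End Evaluation.

Definition amalgam_in i (a : A i) : amalgamated_product phi :=
  qclass _ (fp_in a).

Lemma amalgam_inM i : {morph @amalgam_in i : a b / a * b}.
Proof. by move=> a b; rewrite /amalgam_in fp_inM qclassM. Qed.

Definition amalgam_inj i : ghom (A i) (amalgamated_product phi) :=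
  morph_ghom (@amalgam_inM i).

Lemma amalgam_inj_compat : compatible amalgam_inj.
Proof.
move=> i j c; apply/qclassP.
pose f := morph_ghom (@fp_inM I A i); pose g := morph_ghom (@fp_inM I A j).
(* The coset criterion tests [x^-1 * y], which is the relator of [c^-1]. *)
move=> N _; apply; exists c^-1, i, j.
rewrite !gmulfV [fp_in (phi i c)^-1](gmulfV f) [fp_in (phi j c)^-1](gmulfV g).
by rewrite invgK.
Qed.

(** * Reduced words *)

Fixpoint reduced (w : word A) : Prop :=
  if w is l :: w' then
    [/\ ~ range (phi (tag l)) (tagged l),
        (if w' is m :: _ then tag l != tag m else true) & reduced w']
  else True.


(** Quantifying over all compatible families lets the same [c] and [w'] serve in the separating
    quotient and in the amalgam itself. *)
Lemma reduced_form (w : word A) : exists c w', reduced w' /\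
  forall (H : groupType) (psi : forall i, ghom (A i) H), compatible psi ->
    forall i, ev psi w = psi i (phi i c) * ev psi w'.
Proof.
elim: w => [|[i a] w [c [w' [w'red w'E]]]].
  by exists 1, [::]; split=> // H psi _ i; rewrite !gmulf1 mul1g.
(* Centrality moves the factor from [C] to the left of the new letter. *)
have evE (H : groupType) (psi : forall i, ghom (A i) H) : compatible psi ->
    forall j, ev psi (letter a :: w) = psi j (phi j c) * (psi i a * ev psi w').
  move=> compat j; rewrite ev_letter (w'E _ _ compat i) (compat j i) !mulgA.
  have zc : center (A i) (phi i c) by apply: phi_central; exists c.
  by rewrite -!gmulfM zc.
have [[d _ da]|a_notC] := pselect (range (phi i) a).
  exists (c * d), w'; split=> // H psi compat j.
  by rewrite (evE _ _ compat j) -da (compat i j) mulgA !gmulfM.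
case: w' => [|[j b] w''] in w'red w'E evE *.
  exists c, [:: letter a]; split=> [|H psi compat j]; first by split.
  by rewrite (evE _ _ compat j) ev_letter.
have [ij|ne_ij] := eqVneq i j; last first.
  exists c, [:: letter a, letter b & w'']; split=> [|H psi compat k].
    by split.
  by rewrite (evE _ _ compat k) ev_letter.
subst j; case: w'red => b_notC b_neq w''red.
have evE2 (H : groupType) (psi : forall i, ghom (A i) H) : compatible psi ->
    forall j, ev psi (letter a :: w) =
      psi j (phi j c) * (psi i (a * b) * ev psi w'').
  by move=> compat j; rewrite (evE _ _ compat j) ev_letter gmulfM -mulgA.
(* If the merged letter falls into the image of [C], it joins [c], and the tail is already
   reduced. *)
have [[d _ dab]|ab_notC] := pselect (range (phi i) (a * b)).
  exists (c * d), w''; split=> // H psi compat j.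
  by rewrite (evE2 _ _ compat j) -dab (compat i j) mulgA !gmulfM.
exists c, (letter (a * b) :: w''); split=> [|H psi compat j]; first by split.
by rewrite (evE2 _ _ compat j) ev_letter.
Qed.

(** * Cosets of the amalgamated subgroup and separation of suffixes *)

Section Cosets.
Variables (H : groupType) (psi : forall i, ghom (A i) H).

Definition same_coset (x y : H) : Prop := exists i c, x = psi i (phi i c) * y.

(* The values of the suffixes of [w] lie in distinct cosets of the amalgamated
   subgroup. *)
Fixpoint separated (w : word A) : Prop :=
  if w is l :: w' then
    (forall r s, w' = r ++ s -> ~ same_coset (ev psi w) (ev psi s)) /\ separated w'
  else True.

Hypothesis psi_compat : compatible psi.

Lemma same_coset_sym x y : same_coset x y -> same_coset y x.
Proof. by move=> [i [c ->]]; exists i, c^-1; rewrite !gmulfV mulKg. Qed.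

Lemma same_coset_mulC i c x y :
  same_coset (psi i (phi i c) * x) y <-> same_coset x y.
Proof.
split=> [[j [d]]|[j [d ->]]]; last first.
  by exists i, (c * d); rewrite (psi_compat j i) mulgA !gmulfM.
rewrite (psi_compat j i) => /(canRL (mulKg _)) ->.
by exists i, (c^-1 * d); rewrite mulgA !gmulfM !gmulfV.
Qed.

Lemma same_coset_refl (i : I) x : same_coset x x.
Proof. by exists i, 1; rewrite !gmulf1 mul1g. Qed.

Lemma separated_strict r m s :
  separated (r ++ m :: s) -> ~ same_coset (ev psi (r ++ m :: s)) (ev psi s).
Proof.
case: r => [|n r] [sep _]; first exact: (sep [::]).
by apply: (sep (rcons r m)); rewrite cat_rcons.
Qed.

End Cosets.

Lemma separating_quotient (D : groupType) (psi0 : forall i, ghom (A i) D) :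
  solvable_group D -> compatible psi0 -> (forall i, injective (psi0 i)) ->
  forall w, reduced w ->
  exists (H : groupType) (psi : forall i, ghom (A i) H),
    [/\ solvable_group H, compatible psi, forall i, injective (psi i)
      & separated psi w].
Proof.
move=> solD compat0 inj0; elim=> [_|l w IH [l_notC l_neq /IH]].
  by exists D, psi0.
move=> [H [psi [solH compat inj sep]]].
(* Only the factor of [l] is twisted; for every other index [u i] vanishes. *)
pose u i x := (i == tag l) && `[< same_coset psi x (ev psi w) >].
pose psi' i : ghom (A i) (wreath H) :=
  morph_ghom (twistM (u i)) \o psi i.
exists (wreath H), psi'.
have psi'C i c : psi' i (phi i c) = (fun=> false, psi i (phi i c)) :> wreath H.
  apply: wreath_eq => [x|] //=; rewrite /u.
  by rewrite (asbool_equiv_eq (same_coset_mulC compat _ _ _ _)) addbb.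
have ev_snd s : (ev psi' s).2 = ev psi s.
  elim: s => [|m s IHs]; first by rewrite /ev !big_nil.
  by rewrite !ev_cons -IHs.
have ev_fst m s : (ev psi' (m :: s)).1 1 =
    u (tag m) (ev psi (m :: s)) (+) u (tag m) (ev psi s) (+) (ev psi' s).1 1.
  by rewrite ev_cons [LHS]/= ev_snd mulg1 ev_cons.
have u_suffix i r m s : w = r ++ m :: s -> u i (ev psi s) = false.
  move=> wE; apply: contra_notF (separated_strict (r := r) (m := m) (s := s) _).
    by rewrite -wE => /andP[_ /asboolP]; apply: same_coset_sym.
  by rewrite -wE.
have ev_suffix r s : w = r ++ s -> (ev psi' s).1 1 = false.
  elim: s r => [|m s IHs] r wE; first by rewrite /ev big_nil.
  rewrite ev_fst (u_suffix _ _ _ _ wE) (IHs (rcons r m)) ?cat_rcons // !addbF.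
  (* The term at [m :: s] remains. A proper suffix avoids the marked coset; the whole of [w] lies in
     it, but its first letter comes from a factor other than that of [l]. *)
  case/lastP: r wE => [|r n] wE; last first.
    by apply: (u_suffix _ r n); rewrite wE cat_rcons.
  by rewrite /u eq_sym; move: l_neq; rewrite wE => /negPf->.
split=> //.
- exact: solvable_wreath.
- by move=> i j c; rewrite !psi'C (compat i j).
- by move=> i a b /(congr1 snd)/inj.
split=> [r s wE [i [c lwE]]|].
  (* At [1] the base component would be both 0, as for [s], and 1: the indicator is 1 at [ev psi w],
     and 0 at [ev psi (l :: w)] unless [l] lies in the image of [C]. *)
  have := ev_fst l w; rewrite lwE psi'C /= (ev_suffix _ _ wE) (ev_suffix [::]) //.
  rewrite /u eqxx /= addbF (asboolT (same_coset_refl psi (tag l) (ev psi w))).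
  rewrite asboolF // => -[j [d]]; rewrite ev_cons => /mulIg.
  by rewrite (compat j (tag l)) => /inj dE; apply: l_notC; exists d.
(* Separation of the old suffixes is inherited through the projection to [H]. *)
elim: (w) sep => [//|m s IHs] [sep /IHs sep'] /=; split=> // r t sE [i [c msE]].
apply: (sep r t sE); exists i, c.
by rewrite -!ev_snd msE psi'C.
Qed.

(** * The central product, a solvable group containing all factors compatibly *)

Section CentralProduct.

(** An explicit subgroup, rather than a normal closure, so that injectivity of the factors can be
    read off the coordinates. *)
Definition central_relations : set (direct_product A) :=
  [set p | exists c : I -> C, (forall i, p i = phi i (c i)) /\ \prod_i c i = 1].

Lemma central_relations_normal : is_normal central_relations.
Proof.
have CC (i : I) (c d : C) : commute c d by exact: amalgamated_commute.
split; first split=> [|p q [c [pE c1]] [d [qE d1]]|p [c [pE c1]]].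
- by exists (fun=> 1); split=> [i|]; rewrite ?gmulf1 ?big1.
- exists (fun i => c i * d i); split=> [i|]; first by rewrite gmulfM -pE -qE.
  rewrite prodgM_commute ?c1 ?d1 ?mulg1 // => i j _ _; exact: (CC i).
- exists (fun i => (c i)^-1); split=> [i|]; first by rewrite gmulfV -pE.
  apply: (mulgI (\prod_i c i)); rewrite -prodgM_commute; last first.
    by move=> i j _ _; exact: (CC i).
  by rewrite c1 mulg1 big1 // => i _; rewrite mulgV.
move=> p q [c [pE c1]]; suff -> : p ^ q = p by exists c.
apply: functional_extensionality_dep => i.
have zc : center (A i) (phi i (c i)) by apply: phi_central; exists (c i).
rewrite -[LHS]/((q i)^-1 * (p i * q i)) pE zc mulKg //.
Qed.

Definition central_product : groupType :=
  quotient_group (NormalSubgroup central_relations_normal).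

Lemma central_product_inM i :
  {morph (fun a : A i => qclass _ (dp_in a) : central_product) : a b / a * b}.
Proof. by move=> a b; rewrite dp_inM qclassM. Qed.

Definition central_product_in i : ghom (A i) central_product :=
  morph_ghom (@central_product_inM i).

Lemma dp_in_phi i c j : dp_in (phi i c) j = phi j (if j == i then c else 1).
Proof.
rewrite /dp_in; have [->|ne_ij] := eqVneq j i; first by rewrite dfwith_in.
by rewrite dfwith_out 1?eq_sym // gmulf1.
Qed.

Lemma central_product_in_compat : compatible central_product_in.
Proof.
move=> i j c; apply/qclassP.
have CC := amalgamated_commute i.
(* Writing the tuple as a product also covers the case [i = j]. *)
exists (fun k => (if k == i then c else 1)^-1 * (if k == j then c else 1)).
split=> [k|].
  by rewrite gmulfM gmulfV -!dp_in_phi.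
rewrite prodgM_commute; last by move=> k l _ _; apply: CC.
rewrite -[X in _ * X]big_mkcond big_pred1_eq.
rewrite (eq_bigr (fun k => if k == i then c^-1 else 1)); last first.
  by move=> k _; case: ifP; rewrite ?invg1.
by rewrite -big_mkcond big_pred1_eq mulVg.
Qed.

(** For an element of the kernel all [c j] with [j != i] are trivial, so the product condition
    forces [c i = 1]. *)
Lemma central_product_in_inj i : injective (central_product_in i).
Proof.
apply: gmulf_inj => a a1.
have /qclassP[c [aE c1]] : qclass (NormalSubgroup central_relations_normal) 1 =
  qclass _ (dp_in a) by exact: esym a1.
have {}aE j : dp_in a j = phi j (c j).
  by rewrite -aE -[RHS]/(1^-1 * dp_in a j) invg1 mul1g.
have c_out j : j != i -> c j = 1.
  move=> ne_ji; apply: (@phi_inj j).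
  by rewrite -aE /dp_in dfwith_out 1?eq_sym // gmulf1.
have ci1 : c i = 1 by rewrite -c1 (@big_only1 _ _ _ _ i) // => j /c_out.
by move: (aE i); rewrite /dp_in dfwith_in ci1 gmulf1.
Qed.

Lemma solvable_central_product :
  (forall i, solvable_group (A i)) -> solvable_group central_product.
Proof.
move=> solA.
have qM : {morph @qclass _ (NormalSubgroup central_relations_normal) :
  p q / p * q} by exact: qclassM.
apply: (solvable_image (f := morph_ghom qM)) (solvable_direct_product solA).
by move=> y; exists (repr y); apply: qclassK.
Qed.

End CentralProduct.

(** * Residual solvability of the amalgam *)

Lemma ev_amalgam_inj w : ev amalgam_inj w = qclass _ (wclass w).
Proof.
elim: w => [|[i a] w IH]; first exact: big_nil.
rewrite ev_letter IH -[LHS]qclassM; congr (qclass _ _); exact: fmulE.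
Qed.

Lemma residually_solvable_amalgam (i0 : I) :
  (forall i, solvable_group (A i)) -> residually_solvable (amalgamated_product phi).
Proof.
move=> solA g g_neq1.
have [c [w [w_red gE]]] := reduced_form (repr (repr g)).
have [H [psi [solH compat inj sep]]] :=
  separating_quotient (solvable_central_product solA)
    central_product_in_compat central_product_in_inj w_red.
exists H, (morph_ghom (amalgam_liftM compat)); split=> //= psi_g1.
move: psi_g1; rewrite /amalgam_lift /free_lift (gE _ _ compat i0).
case: w {w_red} gE sep => [|l w] gE sep psi_g1; last first.
  (* A trivial image would put the whole word in the coset of its empty suffix. *)
  apply: (sep.1 w [::]); first by rewrite cats0.
  rewrite [ev _ [::]]big_nil; apply/(same_coset_mulC compat i0 c).
  rewrite psi_g1; exact: same_coset_refl.
(* For the empty word [g] is the image of [c], which injectivity of [psi i0] detects. *)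
apply: g_neq1; rewrite -(qclassK g) -(wclassK (repr g)) -ev_amalgam_inj.
rewrite (gE _ _ amalgam_inj_compat i0) [ev _ _]big_nil mulg1.
move: psi_g1; rewrite [ev _ _]big_nil mulg1 => psi_c1.
have -> : phi i0 c = 1 by apply: (inj i0); rewrite gmulf1.
exact: gmulf1.
Qed.

End Amalgam.

End CentralAmalgam.

Theorem theorem3 (I : finType) (A : I -> groupType) (C : groupType)
    (phi : forall i : I, ghom C (A i))
    (I_nonempty : 0 < #|I|)
    (A_solvable : forall i : I, solvable_group (A i))
    (phi_inj : forall i : I, injective (phi i))
    (phi_central : forall i : I, range (phi i) `<=` center (A i)) :
  residually_solvable (amalgamated_product phi).
Proof.
have /card_gt0P[i0 _] := I_nonempty.
exact: residually_solvable_amalgam.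
Qed.
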